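(* Let $\mathbb{F}$ be an algebraically closed field, let $n$ be a positive integer, and let $Q\subseteq\{2,\ldots,n\}$. If $2,\ldots,\lfloor n/2\rfloor+1\in Q$ (i.e. every integer $j$ with $2\le j\le\lfloor n/2\rfloor+1$ belongs to $Q$), then $M(Q)\in\mathcal{M}_n$. Moreover, if $\operatorname{char}\mathbb{F}=0$ and $Q\neq\varnothing$, then $M(Q)\in\mathcal{M}_n$ if and only if $2,\ldots,\lfloor n/2\rfloor+1\in Q$.
   Context: Let $A=M_n(\mathbb{F})$. $\mathcal{M}_n$ denotes the family of all subsets $M\subseteq A$ consisting of nilpotent matrices such that: (i) $0\in M$; (ii) $gMg^{-1}=M$ for every invertible $g\in A$; (iii) for all $X,Y\in M$ with $XY=YX$, the linear span $\langle X,Y\rangle$ is contained in $M$. For $Q\subseteq\{2,\ldots,n\}$, $M(Q)$ denotes the set of all nilpotent matrices $X\in A$ such that all Jordan cells (blocks) in the Jordan form of $X$ have sizes belonging to $Q\cup\{1\}$. *)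

(* Defs.v *)
From mathcomp Require Export all_boot all_order all_algebra.
From mathcomp Require Export classical_sets.

Set Implicit Arguments.
Unset Strict Implicit.
Unset Printing Implicit Defensive.

Import GRing.Theory.
Local Open Scope ring_scope.
Local Open Scope classical_set_scope.

Section Defs.
Variable F : fieldType.

Definition nilpotent_mx n (X : 'M[F]_n) : Prop := exists k : nat, X ^+ k = 0.

Definition jordan_cell (a : F) (m : nat) : 'M[F]_m :=
  a%:M + \matrix_(i, j) ((i.+1 == j)%N)%:R.

Definition jordan_mx k (a : 'I_k -> F) (m : 'I_k -> nat) :
    'M[F]_(\sum_i m i) :=
  \mxdiag_i jordan_cell (a i) (m i).

(* The positivity condition rules out empty cells, so that the list of cells  *)
(* (a i, m i) is determined by X up to reordering. The equation sm transports *)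
(* the block matrix to 'M_n.                                                  *)
Definition has_jordan_form n (X : 'M[F]_n) k (a : 'I_k -> F) (m : 'I_k -> nat)
    : Prop :=
  (forall i, 0 < m i)%N /\
  exists (sm : (\sum_i m i)%N = n) (g : 'M[F]_n),
    g \in unitmx /\ X = g *m castmx (sm, sm) (jordan_mx a m) *m invmx g.

(* Over an algebraically closed field every X has a Jordan form, unique up to *)
(* the order of the cells, so "exists" picks out the Jordan form of X.        *)
Definition nilpotent_with_cells n (Q : set nat) : set 'M[F]_n :=
  [set X | nilpotent_mx X /\
    exists k (a : 'I_k -> F) (m : 'I_k -> nat),
      has_jordan_form X a m /\ forall i, (Q `|` [set 1%N]) (m i)].

Definition nilpotent_family n : set (set 'M[F]_n) :=
  [set M | [/\ (forall X, M X -> nilpotent_mx X),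
               M 0,
               (forall g : 'M[F]_n, g \in unitmx ->
                  [set g *m X *m invmx g | X in M] = M) &
               (forall X Y : 'M[F]_n, M X -> M Y -> X *m Y = Y *m X ->
                  forall Z, Z \in <<[:: X; Y]>>%VS -> M Z)]].

End Defs.

Arguments nilpotent_with_cells : clear implicits.
Arguments nilpotent_family : clear implicits.

(* Main.v *)
Require Import Defs.
From mathcomp Require Import zify ring.

(** Two facts drive the theorem.

    Sufficiency. Let X and Y be commuting nilpotent matrices of size n and let
    Z = aX + bY have index (largest cell size) s + 1. If s + 1 <= n/2 + 1, all
    cells of Z are allowed. Otherwise n < 2s, and the claim is that X or Y also
    has index s + 1 (pencil_index), so that s + 1 is in Q; the other cells of Z
    share at most n - s - 1 dimensions and are small.

    To prove the claim, take v with Z^s v != 0 and filter the cyclic module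
    F[X, Y] v by the powers of the ideal (X, Y). The filtration has at least
    s + 1 nonzero graded pieces and total dimension at most n < 2s, so some
    intermediate piece is one-dimensional (drop_by_one). As in Macaulay's bound
    on Hilbert functions, the graded module then behaves from there on as one
    over a polynomial ring in a single variable: some linear form g raises
    degrees by two (adic_thin_annihilator), and for every linear form h that is
    not proportional to g, the top graded piece is spanned by h^t v, where t is
    the top degree (adic_generator). The dimension bound also shows that Z is
    not proportional to g, whence t = s; and X and Y cannot both be
    proportional to g.

    Necessity. Starting from any q in Q with q > 2, a single cell X of size q
    and the similar matrix X + X^(q-1) commute, and their difference is a
    nonzero square-zero matrix, which puts 2 into Q. If 2, ..., j are in Q and
    2j <= n, multiplication by x and y on F[x, y]/(x^2, y^j), padded by zeros,
    are in M(Q), and in characteristic zero x + y has index j + 1; so j + 1 is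
    in Q.

    Both parts use the Jordan form of a nilpotent matrix, obtained by splitting
    off maximal cells (nilpotent_split), and the fact that powers determine the
    largest cell (jordan_form_exp_eq0). *)

Set Implicit Arguments.
Unset Strict Implicit.
Unset Printing Implicit Defensive.

Import GRing.Theory.
Local Open Scope ring_scope.
Local Open Scope classical_set_scope.

(** * Ideal-adic filtration of a cyclic module over a commuting pencil *)

Lemma submxB (F : fieldType) m1 m2 n (A B : 'M[F]_(m1, n)) (W : 'M_(m2, n)) :
  (A <= W)%MS -> (B <= W)%MS -> (A - B <= W)%MS.
Proof. by move=> AW BW; rewrite addmx_sub // eqmx_opp. Qed.

Lemma mulmx_neq0_row (F : fieldType) m p (A : 'M[F]_(m, p)) :
  A != 0 -> exists v : 'rV_m, v *m A != 0.
Proof.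
move=> Anz; have /row_subPn[i] : ~~ (A <= (0 : 'M_p))%MS by rewrite submx0.
by rewrite submx0 rowE; exists (delta_mx 0 i).
Qed.

(** Were all the drops at 1, ..., n - t at least 2, the ranks would already
    exceed n: 1 at the start, 2 (n - t) next, and one for each of the
    remaining steps up to t. The bound i + t <= n on the first drop by one is
    what later excludes a degenerate position of the given matrix. *)
Lemma drop_by_one (r : nat -> nat) (n t : nat) :
  (r 0 <= n)%N -> (forall k, (k <= t)%N -> (r k.+1 < r k)%N) -> (n < t.*2)%N ->
  exists i, [/\ (0 < i)%N, (i + t <= n)%N & r i = (r i.+1).+1].
Proof.
move=> r0 rlt ltn2t.
have [/existsP[i /and3P[i0 it /eqP e]]|noi] :=
  boolP [exists i : 'I_n.+1, [&& (0 < i)%N, (i + t <= n)%N & r i == (r i.+1).+1]].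
  by exists i.
have big i : (0 < i)%N -> (i + t <= n)%N -> (r i.+1 + 2 <= r i)%N.
  move=> i0 it; have lin : (i < n.+1)%N by lia.
  move: noi; rewrite negb_exists => /forallP /(_ (Ordinal lin)) /=.
  rewrite i0 it /= => ne.
  have := rlt i ltac:(lia); move/eqP: ne; lia.
have up j : (j <= t.+1)%N -> (j <= r (t.+1 - j))%N.
  elim: j => // j IH jt; have := rlt (t - j)%N ltac:(lia).
  rewrite subSS; have := IH ltac:(lia).
  by rewrite (_ : t.+1 - j = (t - j).+1)%N; lia.
have dn j : (j + t <= n)%N -> (j.*2 + r j.+1 <= r 1)%N.
  elim: j => [|j IH] jt; first by lia.
  have := big j.+1 isT jt; have := IH ltac:(lia); lia.
have tn : (t <= n)%N by have := up t.+1 (leqnn _); rewrite subnn; lia.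
have := rlt 0%N isT; have := dn (n - t)%N ltac:(lia).
have := up (t - (n - t))%N ltac:(lia).
rewrite (_ : t.+1 - (t - (n - t)) = (n - t).+1)%N; lia.
Qed.

Section Filtration.
Variables (F : fieldType) (n : nat).
Implicit Types (X Y U : 'M[F]_n) (v : 'rV[F]_n) (c d : F * F).

(** The members of the pencil spanned by X and Y are indexed by coordinates
    rather than by matrices, because X and Y may be linearly dependent; two
    members count as parallel when their coordinates are. *)
Definition pencil X Y c : 'M[F]_n := c.1 *: X + c.2 *: Y.

(** C k stands for the row space of m^k v, where m is the ideal generated by
    X and Y in the commutative algebra F[X, Y]; the successive quotients are
    the graded pieces of the cyclic module generated by v. *)
Record adic_filtration X Y v (C : nat -> 'M[F]_n) : Prop := AdicFiltration {
  adic_comm : X *m Y = Y *m X;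
  adic0 : (C 0 :=: v + C 1)%MS;
  adicS : forall k, (C k.+1 :=: C k *m X + C k *m Y)%MS;
  adic_vanish : exists N, C N = 0 }.

Lemma pencilC X Y c d : X *m Y = Y *m X ->
  pencil X Y c *m pencil X Y d = pencil X Y d *m pencil X Y c.
Proof.
move=> cXY; rewrite /pencil !mulmxDl !mulmxDr -!scalemxAr -!scalemxAl cXY.
set A := X *m X; set B := Y *m X; set D := Y *m Y.
by apply/matrixP => i j; rewrite !mxE; ring.
Qed.

Lemma pencil_parallel X Y c d : (c.1 != 0) || (c.2 != 0) ->
  c.1 * d.2 = c.2 * d.1 -> exists m, pencil X Y d = m *: pencil X Y c.
Proof.
move=> cnz par; have [c10|c1nz] := eqVneq c.1 0.
  have c2nz : c.2 != 0 by move: cnz; rewrite c10 eqxx.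
  exists (d.2 / c.2); rewrite /pencil scalerDr !scalerA c10 mulr0 divfK //.
  move: par; rewrite c10 mul0r => /esym/eqP; rewrite mulf_eq0 (negPf c2nz).
  by move=> /eqP->.
exists (d.1 / c.1); rewrite /pencil scalerDr !scalerA divfK //.
by congr (_ + _ *: _); rewrite mulrAC -[_ * c.2]mulrC -par mulrAC divff ?mul1r.
Qed.

Section Theory.
Variables (X Y : 'M[F]_n) (v : 'rV[F]_n) (C : nat -> 'M[F]_n).
Hypothesis fC : adic_filtration X Y v C.
Let cXY := adic_comm fC.
Let C0 := adic0 fC.
Let CS := adicS fC.

Lemma adic_mulX m (W : 'M_(m, n)) k : (W <= C k)%MS -> (W *m X <= C k.+1)%MS.
Proof. by move=> Wk; rewrite CS (submx_trans (submxMr _ Wk)) ?addsmxSl. Qed.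

Lemma adic_mulY m (W : 'M_(m, n)) k : (W <= C k)%MS -> (W *m Y <= C k.+1)%MS.
Proof. by move=> Wk; rewrite CS (submx_trans (submxMr _ Wk)) ?addsmxSr. Qed.

Lemma adic_mul m (W : 'M_(m, n)) k c :
  (W <= C k)%MS -> (W *m pencil X Y c <= C k.+1)%MS.
Proof.
move=> Wk; rewrite mulmxDr -!scalemxAr.
by rewrite addmx_sub // scalemx_sub // ?adic_mulX ?adic_mulY.
Qed.

Lemma adic_mulexp m (W : 'M_(m, n)) k c j :
  (W <= C k)%MS -> (W *m pencil X Y c ^+ j <= C (k + j))%MS.
Proof.
move=> Wk; elim: j => [|j IH]; first by rewrite expr0 mulmx1 addn0.
by rewrite exprSr mulmxA addnS adic_mul.
Qed.

Lemma adic_decr k : (C k.+1 <= C k)%MS.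
Proof.
elim: k => [|k IH]; first by rewrite C0 addsmxSr.
by rewrite CS addsmx_sub adic_mulX // adic_mulY.
Qed.

Lemma adic_eq0_up j k : C j = 0 -> (j <= k)%N -> C k = 0.
Proof.
move=> Cj /subnKC <-; elim: (k - j)%N => [|l IH]; first by rewrite addn0.
by apply/eqP; rewrite addnS -submx0 -IH adic_decr.
Qed.

Lemma adic_step k (W : 'M_n) :
  (C k *m X <= W)%MS -> (C k *m Y <= W)%MS -> (C k.+1 <= W)%MS.
Proof. by move=> ? ?; rewrite CS addsmx_sub; apply/andP. Qed.

(** Nakayama: a step C k = C (k+1) = m C k would propagate to all later steps,
    and the filtration reaches 0. *)
Lemma adic_ltmx k : C k != 0 -> ~~ (C k <= C k.+1)%MS.
Proof.
apply: contra => le; have [N CN] := adic_vanish fC.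
have: (C k <= C (k + N))%MS.
  elim: {CN} N => [|N IH]; first by rewrite addn0.
  apply: (submx_trans IH); rewrite addnS.
  elim: {IH} N => [|N IH]; first by rewrite addn0.
  rewrite addnS; apply: adic_step; first exact: adic_mulX.
  exact: adic_mulY.
by move=> kN; rewrite -submx0 (submx_trans kN) // (adic_eq0_up CN) ?leq_addl.
Qed.

Lemma adic_rank_lt k : C k != 0 -> (\rank (C k.+1) < \rank (C k))%N.
Proof.
move=> /adic_ltmx; rewrite ltn_neqAle mxrankS ?adic_decr // andbT.
by apply: contra => /eqP e; rewrite -(mxrank_leqif_sup (adic_decr k)) e.
Qed.

Lemma adic_line k : \rank (C k) = (\rank (C k.+1)).+1 ->
  exists u : 'rV_n, (C k <= u + C k.+1)%MS.
Proof.
move=> rk; have nle : ~~ (C k <= C k.+1)%MS.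
  by apply/negP => /mxrankS; rewrite rk ltnn.
have [j nj] := row_subPn nle; exists (row j (C k)).
have sub : (row j (C k) + C k.+1 <= C k)%MS.
  by rewrite addsmx_sub row_sub adic_decr.
rewrite -(mxrank_leqif_sup sub) eqn_leq mxrankS //= rk.
rewrite ltn_neqAle mxrankS ?addsmxSr // andbT.
by rewrite (mxrank_leqif_sup (addsmxSr _ _)) addsmx_sub submx_refl andbT.
Qed.

Lemma sub_line_adds (w u : 'rV[F]_n) U :
  (w <= u + U)%MS -> exists a, (w - a *: u <= U)%MS.
Proof.
case/sub_addsmxP => -[p q] /= ->; exists (p 0 0).
by rewrite [p in p *m u]mx11_scalar mul_scalar_mx addrC addKr submxMl.
Qed.

(** The step in which commutativity matters. Let u span the one-dimensional
    piece of degree i + 1. For w in C i, write wX = a1 u and wY = a2 u modulo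
    C (i+2); computing wXY in both ways gives a1 uY = a2 uX modulo C (i+3).
    The pairs (a1, a2) obtained from different w are all proportional:
    otherwise uX = uY = 0 modulo C (i+3), hence C (i+2) = C (i+3), which the
    Nakayama argument excludes. So one linear form g, with coordinates
    orthogonal to this common direction, kills C i modulo C (i+2). *)
Lemma adic_thin_annihilator i : \rank (C i.+1) = (\rank (C i.+2)).+1 ->
  C i.+2 != 0 ->
  exists2 c, (c.1 != 0) || (c.2 != 0) & (C i *m pencil X Y c <= C i.+2)%MS.
Proof.
move=> rk nz; have [u Cu] := adic_line rk.
have coef w : (w <= C i)%MS -> exists a : F * F,
    [/\ (w *m X - a.1 *: u <= C i.+2)%MS, (w *m Y - a.2 *: u <= C i.+2)%MS &
        (a.1 *: (u *m Y) - a.2 *: (u *m X) <= C i.+3)%MS].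
  move=> wC.
  have [a wa] := sub_line_adds (submx_trans (adic_mulX wC) Cu).
  have [b wb] := sub_line_adds (submx_trans (adic_mulY wC) Cu).
  exists (a, b); split=> //=.
  have sY : (w *m Y *m X - b *: (u *m X) <= C i.+3)%MS.
    by rewrite scalemxAl -mulmxBl adic_mulX.
  have sX : (w *m X *m Y - a *: (u *m Y) <= C i.+3)%MS.
    by rewrite scalemxAl -mulmxBl adic_mulY.
  have := submxB sY sX; rewrite -!mulmxA -cXY; congr (_ <= _)%MS.
  by rewrite opprB addrC addrA subrK.
have [w0 w0C [a0 [a0X a0Y a0rel a0nz]]] : exists2 w0 : 'rV_n, (w0 <= C i)%MS &
    exists a : F * F, [/\ (w0 *m X - a.1 *: u <= C i.+2)%MS,
      (w0 *m Y - a.2 *: u <= C i.+2)%MS,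
      (a.1 *: (u *m Y) - a.2 *: (u *m X) <= C i.+3)%MS & a != (0, 0)].
  have nzi : C i.+1 != 0 by rewrite -mxrank_eq0 rk.
  have: ~~ ((C i *m X <= C i.+2) && (C i *m Y <= C i.+2))%MS.
    by apply: contra (adic_ltmx nzi) => /andP[]; apply: adic_step.
  have key (G : 'M_n) : ~~ (C i *m G <= C i.+2)%MS ->
      exists2 w0 : 'rV_n, (w0 <= C i)%MS & ~~ (w0 *m G <= C i.+2)%MS.
    by move=> /row_subPn[j]; rewrite row_mul; exists (row j (C i)); rewrite ?row_sub.
  rewrite negb_and => /orP[] /key [];
    move=> w0 w0C nw; exists w0 => //; have [a [aX aY arel]] := coef _ w0C;
    exists a; split=> //; apply: contra nw => /eqP ae.
    by move: aX; rewrite ae scale0r subr0.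
  by move: aY; rewrite ae scale0r subr0.
exists (- a0.2, a0.1).
  by case: (a0) a0nz => x y; rewrite xpair_eqE negb_and oppr_eq0 orbC.
apply/row_subP => j; rewrite row_mul.
have [a [aX aY arel]] := coef _ (row_sub j (C i)); set w := row j (C i) in aX aY *.
(* Solving the two relations between uX and uY by Cramer's rule. *)
have dz : a0.1 * a.2 - a0.2 * a.1 = 0.
  apply/eqP; apply: contraT => dnz.
  have uX : (u *m X <= C i.+3)%MS.
    rewrite -(eqmx_scale _ dnz).
    have -> : (a0.1 * a.2 - a0.2 * a.1) *: (u *m X) =
      a.1 *: (a0.1 *: (u *m Y) - a0.2 *: (u *m X))
      - a0.1 *: (a.1 *: (u *m Y) - a.2 *: (u *m X)).
      by set p := u *m X; set q := u *m Y; apply/rowP => l; rewrite !mxE; ring.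
    by rewrite submxB // scalemx_sub.
  have uY : (u *m Y <= C i.+3)%MS.
    rewrite -(eqmx_scale _ dnz).
    have -> : (a0.1 * a.2 - a0.2 * a.1) *: (u *m Y) =
      a.2 *: (a0.1 *: (u *m Y) - a0.2 *: (u *m X))
      - a0.2 *: (a.1 *: (u *m Y) - a.2 *: (u *m X)).
      by set p := u *m X; set q := u *m Y; apply/rowP => l; rewrite !mxE; ring.
    by rewrite submxB // scalemx_sub.
  case/negP: (adic_ltmx nz); apply: adic_step.
    rewrite (submx_trans (submxMr X Cu)) // addsmxMr addsmx_sub uX.
    by rewrite adic_mulX.
  rewrite (submx_trans (submxMr Y Cu)) // addsmxMr addsmx_sub uY.
  by rewrite adic_mulY.
have -> : w *m pencil X Y (- a0.2, a0.1) =
    a0.1 *: (w *m Y - a.2 *: u) - a0.2 *: (w *m X - a.1 *: u).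
  rewrite /pencil /= mulmxDr -!scalemxAr.
  set p := w *m X; set q := w *m Y; apply/rowP => l; rewrite !mxE.
  by rewrite -[LHS]subr0 -(mul0r (u 0 l)) -dz; ring.
by rewrite submxB // scalemx_sub.
Qed.

Lemma adic_annihilator_up i c k : (C i *m pencil X Y c <= C i.+2)%MS ->
  (C (i + k) *m pencil X Y c <= C (i + k).+2)%MS.
Proof.
move=> Ci; elim: k => [|k IH]; first by rewrite addn0.
have cX : X *m pencil X Y c = pencil X Y c *m X.
  by rewrite mulmxDl mulmxDr -!scalemxAr -!scalemxAl cXY.
have cY : Y *m pencil X Y c = pencil X Y c *m Y.
  by rewrite mulmxDl mulmxDr -!scalemxAr -!scalemxAl cXY.
rewrite addnS (eqmxMr _ (CS _)) addsmxMr addsmx_sub -!mulmxA cX cY !mulmxA.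
by rewrite adic_mulX ?adic_mulY.
Qed.

Lemma adic_coordinates c d k : c.1 * d.2 != c.2 * d.1 ->
  (C k.+1 <= C k *m pencil X Y c + C k *m pencil X Y d)%MS.
Proof.
rewrite -subr_eq0 => dnz; set W := (_ + _)%MS.
have cW : (C k *m pencil X Y c <= W)%MS by rewrite addsmxSl.
have dW : (C k *m pencil X Y d <= W)%MS by rewrite addsmxSr.
apply: adic_step; rewrite -(eqmx_scale _ dnz).
  have -> : (c.1 * d.2 - c.2 * d.1) *: (C k *m X) =
     d.2 *: (C k *m pencil X Y c) - c.2 *: (C k *m pencil X Y d).
    rewrite /pencil !mulmxDr -!scalemxAr.
    by set p := C k *m X; set q := C k *m Y; apply/matrixP => a b;
      rewrite !mxE; ring.
  by rewrite submxB // scalemx_sub.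
have -> : (c.1 * d.2 - c.2 * d.1) *: (C k *m Y) =
   c.1 *: (C k *m pencil X Y d) - d.1 *: (C k *m pencil X Y c).
  rewrite /pencil !mulmxDr -!scalemxAr.
  by set p := C k *m X; set q := C k *m Y; apply/matrixP => a b;
      rewrite !mxE; ring.
by rewrite submxB // scalemx_sub.
Qed.

(** In degree k + 1 every product of linear forms is, modulo products
    containing g = pencil X Y c, the single power of h = pencil X Y d. *)
Lemma adic_generator c d k : c.1 * d.2 != c.2 * d.1 ->
  (C k.+1 <= v *m pencil X Y d ^+ k.+1 + (C k *m pencil X Y c + C k.+2))%MS.
Proof.
move=> dnz; elim: k => [|k IH];
  apply: (submx_trans (adic_coordinates _ dnz)); rewrite addsmx_sub.
  rewrite (submx_trans (addsmxSl _ _) (addsmxSr _ _)) /=.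
  rewrite (eqmxMr _ C0) addsmxMr expr1 addsmxS //.
  exact: submx_trans (adic_mul _ (submx_refl _)) (addsmxSr _ _).
rewrite (submx_trans (addsmxSl _ _) (addsmxSr _ _)) /=.
rewrite (submx_trans (submxMr _ IH)) // addsmxMr addsmxS //.
  by rewrite [in X in (_ <= X)%MS]exprSr mulmxA.
rewrite addsmxMr addsmxS ?adic_mul //.
by rewrite -mulmxA (pencilC _ _ cXY) mulmxA submxMr // adic_mul.
Qed.

(** Let t be the top degree of the filtration of v. A one-dimensional graded
    piece gives a form g with C k g <= C (k+2) from some k < t on; then g kills
    C (t-1), so h^t v spans C t for every h not parallel to g. The form z with
    z^s v != 0 is not parallel to g, since otherwise z^s v would lie too deep in
    the filtration; hence t = s, and at least one of X, Y is not parallel to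
    g. *)
Lemma adic_index a s :
  pencil X Y a ^+ s.+1 = 0 -> v *m pencil X Y a ^+ s != 0 ->
  (n < s.*2)%N ->
  (v *m X ^+ s != 0 \/ v *m Y ^+ s != 0) /\ C s.+1 = 0.
Proof.
move=> a0 vas ns.
have vC : (v <= C 0)%MS by rewrite C0 addsmxSl.
have Cs : C s != 0.
  apply: contra vas => /eqP e; have := adic_mulexp a s vC.
  by rewrite add0n e submx0.
have [t [st Ct Ct1]] : exists t, [/\ (s <= t)%N, C t != 0 & C t.+1 = 0].
  have exN : exists N, C N == 0 by have [N /eqP CN] := adic_vanish fC; exists N.
  case: (ex_minnP exN) => t /eqP Ct tmin.
  have st : (s < t)%N.
    by rewrite ltnNge; apply: contra Cs => ts; rewrite (adic_eq0_up Ct).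
  exists t.-1; rewrite (ltn_predK st) -ltnS (ltn_predK st); split=> //.
  by apply/negP => /tmin; case: (t) st => //= t' _; rewrite ltnn.
have nzle k : (k <= t)%N -> C k != 0.
  by move=> kt; apply: contra Ct => /eqP /adic_eq0_up ->.
have [|k kt||[|i] [//_ it ri]] := @drop_by_one (fun k => \rank (C k)) n t.
- exact: rank_leq_col.
- exact/adic_rank_lt/nzle.
- by rewrite (leq_trans ns) // leq_double.
have [|c cnz Cc] := adic_thin_annihilator ri; first by apply: nzle; lia.
have up k : (i <= k)%N -> (C k *m pencil X Y c <= C k.+2)%MS.
  by move=> /subnKC <-; apply: adic_annihilator_up.
have top d : c.1 * d.2 != c.2 * d.1 -> v *m pencil X Y d ^+ t != 0.
  have t0 : (0 < t)%N by lia.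
  move=> dnz; have := adic_generator t.-1 dnz; rewrite prednK // => Csub.
  apply: contra (nzle _ (leqnn t)) => /eqP e; rewrite -submx0.
  rewrite (submx_trans Csub) // e !addsmx_sub sub0mx Ct1 sub0mx andbT /=.
  by have := up t.-1; rewrite prednK // Ct1; apply; lia.
(* If the given form were parallel to g, each factor beyond the first i would
   gain two degrees, and s factors would reach beyond the top degree t. *)
have /top vat : c.1 * a.2 != c.2 * a.1.
  apply: contra vas => /eqP par.
  have [m am] := pencil_parallel X Y cnz par.
  have fast j : (v *m pencil X Y a ^+ (i + j) <= C (i + j.*2))%MS.
    elim: j => [|j IH]; first by have := adic_mulexp a i vC; rewrite !addn0.
    rewrite addnS doubleS !addnS exprSr mulmxA am -scalemxAr scalemx_sub // -am.
    by rewrite (submx_trans (submxMr _ IH)) // up // leq_addr.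
  have := fast (s - i)%N; rewrite subnKC; last by lia.
  by rewrite (adic_eq0_up Ct1) ?submx0 //; lia.
have ts : t = s.
  apply/eqP; rewrite eqn_leq st andbT leqNgt; apply/negP => lst.
  by move: vat; rewrite -(subnKC lst) exprD a0 mul0r mulmx0 eqxx.
rewrite {}ts in top Ct1 *; split=> //.
have [c20|c2nz] := eqVneq c.2 0.
  right; have := top (0, 1); rewrite /pencil /= scale0r add0r scale1r; apply.
  by move: cnz; rewrite c20 mulr1 mul0r eqxx orbF.
left; have := top (1, 0); rewrite /pencil /= scale0r addr0 scale1r; apply.
by rewrite mulr0 mulr1 eq_sym.
Qed.

End Theory.

(** Multiplication of a row space by the ideal (X, Y). *)
Definition pencil_step X Y U : 'M[F]_n := (U *m X + U *m Y)%MS.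

Lemma pencil_stepS X Y m (A : 'M_(m, n)) U :
  (A *m X <= U)%MS -> (A *m Y <= U)%MS -> (A *m X + A *m Y <= U)%MS.
Proof. by rewrite addsmx_sub => -> ->. Qed.

Lemma iter_pencil_step_sub X Y k U (W : 'M[F]_n) : X *m Y = Y *m X ->
  (forall a b, (a + b = k)%N -> (U *m X ^+ a *m Y ^+ b <= W)%MS) ->
  (iter k (pencil_step X Y) U <= W)%MS.
Proof.
move=> cXY; elim: k U => [|k IH] U UW.
  by have := UW 0 0 erefl; rewrite !expr0 !mulmx1.
rewrite iterSr; apply: IH => a b abk.
rewrite /pencil_step (eqmxMr _ (addsmxMr _ _ _)) addsmxMr addsmx_sub.
have cYX : Y *m X ^+ a = X ^+ a *m Y by apply: commrX; rewrite /GRing.comm -[LHS]cXY.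
have := UW a.+1 b; rewrite exprS mulmxA => -> /=; last by rewrite addSn abk.
have := UW a b.+1; rewrite exprS !mulmxA -[U *m _ *m Y]mulmxA -cYX mulmxA.
by apply; rewrite addnS abk.
Qed.

(** The filtration starts from F[X, Y] v, which is the sum of the spaces m^i v
    restricted to i < a + b: a monomial of higher degree contains X^a or Y^b. *)
Lemma adic_filtration_exists X Y (v : 'rV[F]_n) : X *m Y = Y *m X ->
  nilpotent_mx X -> nilpotent_mx Y -> exists C, adic_filtration X Y v C.
Proof.
move=> cXY [a Xa] [b Yb].
pose D k := iter k (pencil_step X Y) <<v>>%MS.
pose base := (\sum_(i < (a + b)%N) D i)%MS.
have D0 k : (a + b <= k)%N -> D k = 0.
  move=> abk; apply/eqP; rewrite -submx0; apply: iter_pencil_step_sub => // p q pq.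
  have [ap|pa] := leqP a p.
    by rewrite -(subnKC ap) exprD Xa mul0r mulmx0 mul0mx sub0mx.
  have bq : (b <= q)%N by lia.
  by rewrite -(subnKC bq) exprD Yb mul0r mulmx0 sub0mx.
have Dbase k : (D k <= base)%MS.
  have [kab|abk] := ltnP k (a + b)%N; last by rewrite D0 ?sub0mx.
  exact: (sumsmx_sup (Ordinal kab)).
have DS k : D k.+1 = pencil_step X Y (D k) by [].
have stable : (pencil_step X Y base <= base)%MS.
  apply: pencil_stepS; rewrite sumsmxMr; apply/sumsmx_subP => i _;
    apply: submx_trans (Dbase i.+1); rewrite DS; [exact: addsmxSl|exact: addsmxSr].
pose C k := iter k (pencil_step X Y) base.
exists C; split=> //.
- apply/eqmxP; rewrite addsmx_sub stable andbT; apply/andP; split; last first.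
    by rewrite -(genmxE v) (Dbase 0).
  apply/sumsmx_subP => -[[|i] lti] _ /=; first by rewrite /D /= genmxE addsmxSl.
  apply: submx_trans (addsmxSr _ _); rewrite /C /= /pencil_step.
  by rewrite addsmxS // submxMr // Dbase.
- exists (a + b)%N; apply/eqP; rewrite -submx0; apply: iter_pencil_step_sub => // p q pq.
  have [ap|pa] := leqP a p.
    by rewrite -(subnKC ap) exprD Xa mul0r mulmx0 mul0mx sub0mx.
  have bq : (b <= q)%N by lia.
  by rewrite -(subnKC bq) exprD Yb mul0r mulmx0 sub0mx.
Qed.

(** In a commuting nilpotent pencil, an index s + 1 with n < 2s is attained by
    X or by Y. By adic_index this holds on each vector not killed by Z^s;
    such vectors generate the whole space, because adding one of them to a
    vector killed by Z^s gives another one. *)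
Lemma pencil_index X Y a s : X *m Y = Y *m X ->
  nilpotent_mx X -> nilpotent_mx Y ->
  pencil X Y a ^+ s.+1 = 0 -> pencil X Y a ^+ s != 0 -> (n < s.*2)%N ->
  (X ^+ s.+1 = 0 /\ X ^+ s != 0) \/ (Y ^+ s.+1 = 0 /\ Y ^+ s != 0).
Proof.
move=> cXY nX nY Z1 Zs ns.
have loc (v : 'rV_n) : v *m pencil X Y a ^+ s != 0 ->
   (v *m X ^+ s != 0 \/ v *m Y ^+ s != 0) /\
   (v *m X ^+ s.+1 = 0 /\ v *m Y ^+ s.+1 = 0).
  move=> vZ; have [C fC] := adic_filtration_exists v cXY nX nY.
  have [XY C0] := adic_index fC Z1 vZ ns; split=> //.
  have vC : (v <= C 0)%MS by rewrite (adic0 fC) addsmxSl.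
  have van d : v *m pencil X Y d ^+ s.+1 = 0.
    by apply/eqP; rewrite -submx0 -C0 -[s.+1]add0n (adic_mulexp fC).
  have := (van (1, 0), van (0, 1)).
  by rewrite /pencil /= !scale0r !scale1r addr0 add0r => -[].
have [v vZ] := mulmx_neq0_row Zs.
(* A matrix that kills every vector outside the kernel of Z^s is zero. *)
have glob (G : 'M[F]_n) :
  (forall w : 'rV_n, w *m pencil X Y a ^+ s != 0 -> w *m G = 0) -> G = 0.
  move=> van; apply/eqP; apply: contraT => /mulmx_neq0_row[w wG].
  have wZ : w *m pencil X Y a ^+ s = 0.
    by apply/eqP; apply: contraT => /van e; rewrite e eqxx in wG.
  have := van (v + w); rewrite !mulmxDl wZ addr0 (van _ vZ) add0r => /(_ vZ) e.
  by rewrite e eqxx in wG.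
have neq0 (G : 'M[F]_n) : v *m G != 0 -> G != 0.
  by apply: contra => /eqP->; rewrite mulmx0.
case: (loc v vZ) => -[] /neq0 nz _; [left | right]; split=> //;
  by apply: glob => w /loc[_ []].
Qed.
End Filtration.

(** * Similarity and powers of Jordan matrices *)

Section Similarity.
Variable F : fieldType.

(** Similarity is stated between matrices of a priori different sizes, so that
    block decompositions of n need no casts; the sizes are equal by
    similar_mx_size. *)
Definition similar_mx n m (A : 'M[F]_n) (B : 'M[F]_m) : Prop :=
  exists (P : 'M_(m, n)) (P' : 'M_(n, m)),
    [/\ P *m P' = 1%:M, P' *m P = 1%:M & P *m A = B *m P].

Lemma similar_mx_refl n (A : 'M[F]_n) : similar_mx A A.
Proof. by exists 1%:M, 1%:M; rewrite !mulmx1 mul1mx. Qed.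

Lemma similar_mx_sym n m (A : 'M[F]_n) (B : 'M[F]_m) :
  similar_mx A B -> similar_mx B A.
Proof.
move=> [P [P' [PP' P'P PA]]]; exists P', P; split=> //.
by rewrite -[LHS]mulmx1 -PP' mulmxA -[P' *m B *m P]mulmxA -PA !mulmxA P'P mul1mx.
Qed.

Lemma similar_mx_trans n m p (A : 'M[F]_n) (B : 'M[F]_m) (D : 'M[F]_p) :
  similar_mx A B -> similar_mx B D -> similar_mx A D.
Proof.
move=> [P [P' [PP' P'P PA]]] [R [R' [RR' R'R RB]]]; exists (R *m P), (P' *m R').
split; last by rewrite -mulmxA PA !mulmxA RB.
  by rewrite mulmxA -[R *m P *m P']mulmxA PP' mulmx1.
by rewrite mulmxA -[P' *m R' *m R]mulmxA R'R mulmx1.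
Qed.

Lemma similar_mx_size n m (A : 'M[F]_n) (B : 'M[F]_m) : similar_mx A B -> n = m.
Proof.
move=> [P [P' [PP' P'P _]]]; apply/eqP; rewrite eqn_leq.
by rewrite (mulmx1_min PP') (mulmx1_min P'P).
Qed.

Lemma similar_mx_exp n m (A : 'M[F]_n) (B : 'M[F]_m) k :
  similar_mx A B -> similar_mx (A ^+ k) (B ^+ k).
Proof.
move=> [P [P' [PP' P'P PA]]]; exists P, P'; split=> //.
elim: k => [|k IH]; first by rewrite !expr0 mulmx1 mul1mx.
by rewrite !exprS !mulmxA PA -!mulmxA IH.
Qed.

Lemma similar_mx_rank n m (A : 'M[F]_n) (B : 'M[F]_m) :
  similar_mx A B -> \rank A = \rank B.
Proof.
move=> [P [P' [PP' P'P PA]]]; apply/eqP; rewrite eqn_leq.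
have -> : A = P' *m B *m P by rewrite -mulmxA -PA mulmxA P'P mul1mx.
rewrite (leq_trans (mxrankM_maxl _ _)) ?mxrankM_maxr //=.
have {1}-> : B = P *m (P' *m B *m P) *m P'.
  by rewrite !mulmxA PP' mul1mx -mulmxA PP' mulmx1.
by rewrite (leq_trans (mxrankM_maxl _ _)) ?mxrankM_maxr.
Qed.

Lemma similar_mx_eq0 n m (A : 'M[F]_n) (B : 'M[F]_m) :
  similar_mx A B -> (A == 0) = (B == 0).
Proof. by move=> /similar_mx_rank e; rewrite -!mxrank_eq0 e. Qed.

Lemma similar_mx_block n m p (J : 'M[F]_p) (A : 'M[F]_n) (B : 'M[F]_m) :
  similar_mx A B -> similar_mx (block_mx J 0 0 A) (block_mx J 0 0 B).
Proof.
move=> [P [P' [PP' P'P PA]]].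
exists (block_mx 1%:M 0 0 P), (block_mx 1%:M 0 0 P').
by split; rewrite !mulmx_block ?(mul0mx, mulmx0, mulmx1, mul1mx, addr0, add0r)
  ?PP' ?P'P ?PA // -scalar_mx_block.
Qed.

Lemma similar_mx_castmx n m (e : n = m) (A : 'M[F]_n) :
  similar_mx A (castmx (e, e) A).
Proof. by case: m / e; rewrite castmx_id; apply: similar_mx_refl. Qed.

Lemma similar_mx_conj n (g A : 'M[F]_n) :
  g \in unitmx -> similar_mx (g *m A *m invmx g) A.
Proof.
move=> ug; exists (invmx g), g; rewrite mulVmx // mulmxV //.
by split=> //; rewrite !mulmxA mulVmx // mul1mx.
Qed.

Lemma has_jordan_formP n (A : 'M[F]_n) k a (m : 'I_k -> nat) :
  has_jordan_form A a m <-> (forall i, (0 < m i)%N) /\ similar_mx A (jordan_mx a m).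
Proof.
split=> -[m0 h]; split=> //.
  have [sm [g [ug ->]]] := h; apply: similar_mx_trans (similar_mx_conj _ ug) _.
  exact/similar_mx_sym/similar_mx_castmx.
have sm := esym (similar_mx_size h); exists sm; move: (jordan_mx a m) h.
case: n / sm A => A J [P [P' [PP' P'P PA]]]; exists P'.
have uP' : P' \in unitmx by have [] := mulmx1_unit PP'.
split=> //; rewrite castmx_id.
have -> : invmx P' = P by rewrite -[LHS]mul1mx -PP' -mulmxA mulmxV ?mulmx1.
by rewrite -mulmxA -PA mulmxA P'P mul1mx.
Qed.

Lemma jordan_cellE p (i j : 'I_p) : jordan_cell (0 : F) p i j = (i.+1 == j)%:R.
Proof. by rewrite !mxE mul0rn add0r. Qed.

Lemma jordan_cell_exp p k (i j : 'I_p) :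
  (jordan_cell (0 : F) p ^+ k) i j = (i + k == j)%N%:R.
Proof.
elim: k i j => [|k IH] i j; first by rewrite expr0 mxE addn0.
rewrite exprSr mxE.
have [ik|ik] := ltnP (i + k) p; last first.
  rewrite big1 => [|l _]; last first.
    by rewrite IH; case: eqP => [e|_]; [have := ltn_ord l; lia|rewrite mul0r].
  by case: eqP => [e|//]; have := ltn_ord j; lia.
rewrite (bigD1 (Ordinal ik)) //= IH eqxx mul1r big1 => [|l nl].
  by rewrite jordan_cellE addr0 addnS.
by rewrite IH; case: eqP => [e|_]; [case/eqP: nl; apply: val_inj | rewrite mul0r].
Qed.

Lemma jordan_cell_exp_eq0 p k : (jordan_cell (0 : F) p ^+ k == 0) = (p <= k)%N.
Proof.
apply/eqP/idP => [e|pk]; last first.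
  apply/matrixP => i j; rewrite jordan_cell_exp mxE.
  by case: eqP => // e; have := ltn_ord j; lia.
rewrite leqNgt; apply/negP => kp; have p0 : (0 < p)%N by lia.
have := jordan_cell_exp k (Ordinal p0) (Ordinal kp).
by rewrite e mxE /= eqxx => /eqP; rewrite eq_sym oner_eq0.
Qed.

(** The last basis vector is a left eigenvector of the cell for a, so the k-th
    power of the cell multiplies it by a^k. *)
Lemma jordan_cell_nilpotent (a : F) p k :
  (0 < p)%N -> jordan_cell a p ^+ k = 0 -> a = 0.
Proof.
case: p => // p _ e.
have d1 : delta_mx 0 ord_max *m jordan_cell a p.+1 = a *: delta_mx (0 : 'I_1) ord_max.
  rewrite -rowE; apply/rowP => j; rewrite !mxE /= (eq_sym ord_max).
  have -> : (p.+1 == j :> nat) = false by apply/negP => /eqP ej; have := ltn_ord j; lia.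
  by rewrite addr0 mulr_natr.
have : delta_mx (0 : 'I_1) ord_max *m jordan_cell a p.+1 ^+ k = a ^+ k *: delta_mx 0 ord_max.
  elim: k {e} => [|k IH]; first by rewrite !expr0 mulmx1 scale1r.
  by rewrite exprS mulmxA d1 -scalemxAl IH scalerA exprS.
rewrite e mulmx0 => /esym/matrixP/(_ 0 ord_max); rewrite !mxE !eqxx mulr1.
by move=> /eqP; rewrite expf_eq0 => /andP[_ /eqP].
Qed.

Lemma mxdiag_exp k (m : 'I_k -> nat) (B : forall i, 'M[F]_(m i)) j :
  (\mxdiag_i B i) ^+ j = \mxdiag_i (B i ^+ j).
Proof.
elim: j => [|j IH]; first exact: esym (mxdiagZ 1).
rewrite exprS IH -[LHS]/(_ *m _) /mxdiag mul_mxdiag_mxblock.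
apply/eq_mxblock => i l; case: eqVneq => [e|_]; last by rewrite mulmx0.
by case: _ / e; rewrite !conform_mx_id exprS.
Qed.

Lemma jordan_mx_exp_eq0 k (m : 'I_k -> nat) j (a : 'I_k -> F) :
  jordan_mx a m ^+ j = 0 <-> forall i, jordan_cell (a i) (m i) ^+ j = 0.
Proof.
rewrite /jordan_mx mxdiag_exp; split=> [|e].
  by rewrite -[RHS]mxdiag0 => /eq_mxdiagP.
by rewrite -[RHS]mxdiag0; apply/eq_mxdiagP.
Qed.
End Similarity.

(** * Jordan form of a nilpotent matrix *)

Section JordanForm.
Variable F : fieldType.

Lemma nilpotent_mx_index n (X : 'M[F]_n) : (0 < n)%N -> nilpotent_mx X ->
  exists p, X ^+ p.+1 = 0 /\ X ^+ p != 0.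
Proof.
case: n X => // n X _ [q Xq].
have exq : exists q, X ^+ q == 0 by exists q; apply/eqP.
case: (ex_minnP exq) => [[|p] /eqP Xp pmin].
  by move/eqP: Xp; rewrite expr0 -mxrank_eq0 -[1]/(1%:M) mxrank1.
by exists p; split=> //; apply/negP => /pmin; rewrite ltnn.
Qed.

Lemma block_diag_exp p r (A : 'M[F]_p) (B : 'M[F]_r) k :
  (block_mx A 0 0 B) ^+ k = block_mx (A ^+ k) 0 0 (B ^+ k).
Proof.
elim: k => [|k IH]; first exact: scalar_mx_block.
rewrite !exprS IH -[LHS]/(_ *m _) mulmx_block.
by rewrite !mul0mx !mulmx0 !addr0 add0r.
Qed.

(** Splitting off a cell of maximal size. With v X^p e_l != 0, the rows v X^i
    form U and the columns X^(p-j) e_l form T. Both are chains, UX = JU and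
    XT = TJ, and UT is triangular with nonzero diagonal, so the rows of U span
    an X-stable complement to the X-stable space ker T. *)
Lemma nilpotent_split n (X : 'M[F]_n) p : X ^+ p.+1 = 0 -> X ^+ p != 0 ->
  exists r (X' : 'M[F]_r), (p.+1 + r)%N = n /\
    similar_mx X (block_mx (jordan_cell 0 p.+1) 0 0 X').
Proof.
move=> X1 Xp; set J := jordan_cell 0 p.+1.
have [v [l vl]] : exists (v : 'rV_n) l, (v *m X ^+ p) 0 l != 0.
  have [v] := mulmx_neq0_row Xp; rewrite -[_ *m _]mulmx1 => nz; exists v.
  by have /rV0Pn[l] := nz; rewrite mulmx1; exists l.
pose phi : 'cV[F]_n := delta_mx l 0.
pose U := \matrix_(i < p.+1) (v *m X ^+ i).
pose T := (\matrix_(j < p.+1) (X ^+ (p - j) *m phi)^T)^T.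
have UX : U *m X = J *m U.
  apply/row_matrixP => i; rewrite !row_mul rowK -mulmxA -[X ^+ i *m X]exprSr.
  have rJ : row i J = if (i.+1 < p.+1)%N then delta_mx 0 (inord i.+1) else 0.
    apply/rowP => j; rewrite mxE jordan_cellE; case: ltnP => ip; rewrite !mxE ?eqxx //=.
      by rewrite -val_eqE /= inordK // eq_sym.
    by case: eqP => // e; have := ltn_ord j; lia.
  rewrite rJ; case: ltnP => ip; first by rewrite -rowE rowK inordK.
  have -> : i.+1 = p.+1 by have := ltn_ord i; lia.
  by rewrite X1 mulmx0 mul0mx.
have XT : X *m T = T *m J.
  apply: trmx_inj; rewrite !trmx_mul trmxK.
  apply/row_matrixP => i; rewrite !row_mul rowK -trmx_mul mulmxA -[X *m _]exprS.
  have rJ : row i J^T = if (0 < i)%N then delta_mx 0 (inord i.-1) else 0.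
    have ip := ltn_ord i.
    apply/rowP => j; rewrite 2!mxE jordan_cellE; case: ltnP => i0; rewrite !mxE ?eqxx //=.
      by rewrite -val_eqE /= inordK; [congr (nat_of_bool _)%:R; lia|lia].
    by case: eqP => // e; lia.
  have ip := ltn_ord i; rewrite rJ; case: ltnP => i0.
    by rewrite -rowE rowK inordK; [congr (X ^+ _ *m _)^T; lia|lia].
  have -> : (p - i).+1 = p.+1 by lia.
  by rewrite X1 !mul0mx trmx0.
have G i j : (U *m T) i j = (v *m X ^+ (i + (p - j))) 0 l.
  rewrite exprD mulmxA -[(_ *m X ^+ (p - j)) 0 l]/((_ *m _) 0 l).
  transitivity ((row i U *m (X ^+ (p - j) *m phi)) 0 0).
    by rewrite rowK !mxE; apply: eq_bigr => k _; rewrite !mxE.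
  by rewrite rowK mulmxA -colE mxE.
have uG : U *m T \in unitmx.
  rewrite -unitmx_tr unitmxE det_trig; last first.
    apply/is_trig_mxP => i j ij; rewrite mxE G.
    have -> : (j + (p - i) = p.+1 + (j - i).-1)%N by have := ltn_ord i; lia.
    by rewrite exprD X1 mul0r mulmx0 mxE.
  rewrite unitfE; apply/prodf_neq0 => i _; rewrite mxE G subnKC // -ltnS.
  exact: ltn_ord.
have rT : \rank T = p.+1.
  apply/eqP; rewrite eqn_leq rank_leq_col /= -{1}(mxrank_unit uG).
  exact: mxrankM_maxr.
have pn : (p.+1 <= n)%N by rewrite -rT rank_leq_row.
pose K := row_base (kermx T).
have rK : (p.+1 + \rank (kermx T))%N = n by rewrite mxrank_ker rT subnKC.
have KT : K *m T = 0 by apply/eqP; rewrite -sub_kermx eq_row_base.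
pose X' := K *m X *m pinvmx K.
have KX : K *m X = X' *m K.
  by rewrite mulmxKpV // eq_row_base sub_kermx -mulmxA XT mulmxA KT mul0mx.
exists (\rank (kermx T)), X'; split=> //.
pose P := col_mx U K.
have fP : row_free P.
  apply: inj_row_free => w; rewrite -[w]hsubmxK mul_row_col => e.
  have w1 : lsubmx w = 0.
    have := congr1 (mulmx^~ T) e.
    rewrite /= mulmxDl -(mulmxA _ U) -(mulmxA _ K) KT mulmx0 addr0 mul0mx.
    by move=> h; rewrite -[LHS](mulmxK uG) h mul0mx.
  move: e; rewrite w1 mul0mx add0r => /eqP; rewrite mulmx_free_eq0 ?row_base_free //.
  by move=> /eqP ->; rewrite row_mx0.
have uP : row_full P by rewrite -col_leq_rank (eqP fP) rK.
exists P, (pinvmx P); split; [exact: mulmxVp|exact: mulVpmx|].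
by rewrite mul_col_mx UX KX mul_block_col !mul0mx addr0 add0r.
Qed.

(** The cell sizes are given by a list because the sizes of p :: s, reindexed
    along lift ord0, are then those of s by computation. *)
Lemma nilpotent_jordan_form n (X : 'M[F]_n) : nilpotent_mx X ->
  exists s : seq nat,
    has_jordan_form X (fun=> 0) (fun i : 'I_(size s) => nth 0%N s i).
Proof.
have [N] := ubnP n; elim: N n X => // N IH n X nN [q Xq].
case: n => [|n] in X nN Xq *.
  exists [::]; apply/has_jordan_formP; split; first by case.
  have z : (\sum_(i < size (@nil nat)) nth 0%N [::] i = 0)%N by apply: big1 => -[].
  exists 0, 0; split; apply/matrixP => i; exfalso;
    have := leq_ltn_trans (leq0n _) (ltn_ord i);
    by rewrite ?z.
have [p] := nilpotent_mx_index (ltn0Sn n) (ex_intro _ q Xq).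
move=> [Xp1 Xp]; have [r [X' [rn XX']]] := nilpotent_split Xp1 Xp.
have X'p : X' ^+ p.+1 = 0.
  have := similar_mx_eq0 (similar_mx_exp p.+1 XX'); rewrite Xp1 eqxx block_diag_exp => /esym/eqP.
  by rewrite -block_mx0 => /eq_block_mx[].
have [|s /has_jordan_formP[s0 sX]] := IH r X' _ (ex_intro _ _ X'p); first by lia.
exists (p.+1 :: s); apply/has_jordan_formP; split.
  by move=> i; case: (unliftP ord0 i) => [j|] -> //; apply: s0.
apply: similar_mx_trans XX' _; rewrite /jordan_mx mxdiag_recl.
apply: similar_mx_trans (similar_mx_castmx _ _); exact: similar_mx_block sX.
Qed.
End JordanForm.

(** * Cell sizes from index and rank; sufficiency *)

Section CellSizes.
Variable F : fieldType.

Lemma jordan_form_exp_eq0 n (X : 'M[F]_n) k a (m : 'I_k -> nat) :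
  nilpotent_mx X -> has_jordan_form X a m ->
  forall j, X ^+ j = 0 <-> forall i, (m i <= j)%N.
Proof.
move=> [q Xq] /has_jordan_formP[m0 sX] j.
have Xj e : X ^+ e = 0 <-> forall i, jordan_cell (a i) (m i) ^+ e = 0.
  rewrite -jordan_mx_exp_eq0; have := similar_mx_eq0 (similar_mx_exp e sX) => Xe.
  by split=> /eqP h; apply/eqP; move: h; rewrite Xe.
have a0 i : a i = 0 by have /Xj/(_ i) := Xq; apply: jordan_cell_nilpotent.
rewrite Xj; split=> h i; first by rewrite -(jordan_cell_exp_eq0 F) -(a0 i) h.
by apply/eqP; rewrite a0 jordan_cell_exp_eq0.
Qed.

Lemma jordan_form_max_cell n (X : 'M[F]_n) k a (m : 'I_k -> nat) p :
  has_jordan_form X a m -> X ^+ p.+1 = 0 -> X ^+ p != 0 ->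
  exists i, m i = p.+1.
Proof.
move=> jX X1 Xp; have nX : nilpotent_mx X by exists p.+1.
have mp := (jordan_form_exp_eq0 nX jX p.+1).1 X1.
have [/existsP[i /eqP]|/existsPn noi] := boolP [exists i, m i == p.+1]; first by exists i.
case/eqP: Xp; apply/(jordan_form_exp_eq0 nX jX) => i.
by rewrite -ltnS ltn_neqAle noi mp.
Qed.

Lemma jordan_form_size n (X : 'M[F]_n) k a (m : 'I_k -> nat) :
  has_jordan_form X a m -> (\sum_i m i)%N = n.
Proof. by move=> [_ [sm _]]. Qed.

(** Deleting the last row and the first column leaves an identity matrix. *)
Lemma jordan_cell_rank_ge p : (p <= \rank (jordan_cell (0 : F) p.+1))%N.
Proof.
set J := jordan_cell _ _.
have e : mxsub (widen_ord (leqnSn p)) (lift ord0) J = 1%:M.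
  by apply/matrixP => i j; rewrite mxE jordan_cellE !mxE -val_eqE.
rewrite -{1}(mxrank1 F p) -{}e.
have -> : mxsub (widen_ord (leqnSn p)) (lift ord0) J =
    rowsub (widen_ord (leqnSn p)) (colsub (lift ord0) J).
  by apply/matrixP => i j; rewrite !mxE.
rewrite rowsubE -{1}[J]mulmx1 -mulmx_colsub.
exact: leq_trans (mxrankM_maxr _ _) (mxrankM_maxl _ _).
Qed.

Lemma jordan_form_rank n (X : 'M[F]_n) k a (m : 'I_k -> nat) :
  has_jordan_form X a m -> \rank X = (\sum_i \rank (jordan_cell (a i) (m i)))%N.
Proof. by move=> /has_jordan_formP[_ /similar_mx_rank ->]; rewrite rank_mxdiag. Qed.

(** The rank is the sum of the ranks of the cells, and the cell of size p + 1
    uses all of it; the other cells vanish, that is, have size one. *)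
Lemma jordan_form_single_cell n (X : 'M[F]_n) s p :
  has_jordan_form X (fun=> 0) (fun i : 'I_(size s) => nth 0%N s i) ->
  X ^+ p.+1 = 0 -> X ^+ p != 0 -> (\rank X <= p)%N ->
  forall i : 'I_(size s), nth 0%N s i = p.+1 \/ nth 0%N s i = 1%N.
Proof.
move=> jX X1 Xp; rewrite (jordan_form_rank jX).
have [i0 mi0] := jordan_form_max_cell jX X1 Xp.
rewrite (bigD1 i0) //= mi0 => rp i.
have [->|ni] := eqVneq i i0; [by left | right].
have pos := jX.1 i.
move: rp; rewrite (bigD1 i) //= => rp; have := jordan_cell_rank_ge p => rJ.
have r0 : \rank (jordan_cell (0 : F) (nth 0%N s i)) = 0%N by lia.
apply/eqP; rewrite eqn_leq pos andbT -(jordan_cell_exp_eq0 F) expr1.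
by rewrite -mxrank_eq0 r0.
Qed.
End CellSizes.

Section CellFamily.
Variables (F : fieldType) (n : nat) (Q : set nat).
Implicit Types X Y : 'M[F]_n.
Notation M := (nilpotent_with_cells F n Q).

Lemma max_cell_allowed X p : M X -> X ^+ p.+1 = 0 -> X ^+ p != 0 -> (0 < p)%N ->
  Q p.+1.
Proof.
move=> [_ [k [a [m [jX mQ]]]]] X1 Xp p0.
by have [i mi] := jordan_form_max_cell jX X1 Xp; have [] := mQ i; rewrite mi //=; lia.
Qed.

(** One cell has size p + 1, so that the others fit in the remaining
    n - (p + 1) dimensions. *)
Lemma nilpotent_with_cells_max X p : X ^+ p.+1 = 0 -> X ^+ p != 0 ->
  ((0 < p)%N -> Q p.+1) ->
  (forall j, (2 <= j <= p)%N -> (j + p.+1 <= n)%N -> Q j) -> M X.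
Proof.
move=> X1 Xp Qp Qj; have nX : nilpotent_mx X by exists p.+1.
split=> //; have [s jX] := nilpotent_jordan_form nX.
exists (size s), (fun=> 0), (fun i => nth 0%N s i); split=> // i.
have [i0 mi0] := jordan_form_max_cell jX X1 Xp.
have pos := jX.1 i; have le := (jordan_form_exp_eq0 nX jX p.+1).1 X1 i.
have := jordan_form_size jX; rewrite (bigD1 i0) //= mi0 => sz.
have [e|ne] := eqVneq i i0.
  rewrite e mi0; case: (p) Qp => [_|p' /(_ isT) ?]; [by right | by left].
move: sz; rewrite (bigD1 i) //= => sz.
have [e1|n1] := eqVneq (nth 0%N s i) 1%N; first by right.
left; have [e|nep] := eqVneq (nth 0%N s i) p.+1.
  by rewrite e; apply: Qp; lia.
by apply: Qj; lia.
Qed.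

Lemma nilpotent_with_cells_small X k : X ^+ k = 0 ->
  (forall j, (2 <= j <= k)%N -> Q j) -> M X.
Proof.
move=> Xk Qj; have nX : nilpotent_mx X by exists k.
split=> //; have [s jX] := nilpotent_jordan_form nX.
exists (size s), (fun=> 0), (fun i => nth 0%N s i); split=> // i.
have pos := jX.1 i; have le := (jordan_form_exp_eq0 nX jX k).1 Xk i.
have [e1|n1] := eqVneq (nth 0%N s i) 1%N; first by right.
by left; apply: Qj; lia.
Qed.

Lemma nilpotent_with_cells_single X p : X ^+ p.+1 = 0 -> X ^+ p != 0 ->
  (\rank X <= p)%N -> Q p.+1 -> M X.
Proof.
move=> X1 Xp rX Qp; have nX : nilpotent_mx X by exists p.+1.
split=> //; have [s jX] := nilpotent_jordan_form nX.
exists (size s), (fun=> 0), (fun i => nth 0%N s i); split=> // i.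
by have [->|->] := jordan_form_single_cell jX X1 Xp rX i; [left | right].
Qed.

Lemma nilpotent_with_cells_conj X g :
  g \in unitmx -> M X -> M (g *m X *m invmx g).
Proof.
move=> ug [[q Xq] [k [a [m [jX mQ]]]]]; have sX := similar_mx_conj X ug; split.
  by exists q; apply/eqP; rewrite (similar_mx_eq0 (similar_mx_exp q sX)) Xq.
exists k, a, m; split=> //; have [m0 jsX] := (has_jordan_formP _ _ _).1 jX.
by apply/has_jordan_formP; split=> //; apply: similar_mx_trans jsX.
Qed.

Lemma nilpotent_pencil X Y c :
  X *m Y = Y *m X -> nilpotent_mx X -> nilpotent_mx Y ->
  nilpotent_mx (pencil X Y c).
Proof.
move=> cXY [p Xp] [q Yq]; exists (p + q)%N.
have cc : GRing.comm (c.1 *: X) (c.2 *: Y).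
  rewrite /GRing.comm -[LHS]/(_ *m _) -[RHS]/(_ *m _).
  by rewrite -!scalemxAl -!scalemxAr cXY !scalerA mulrC.
have scale (a : F) k (W : 'M[F]_n) : W ^+ k = 0 -> (a *: W) ^+ k = 0.
  suff -> : (a *: W) ^+ k = a ^+ k *: W ^+ k by move=> ->; rewrite scaler0.
  elim: k => [|k IH]; first by rewrite !expr0 scale1r.
  rewrite !exprS IH; transitivity ((a *: W) *m (a ^+ k *: W ^+ k)) => //.
  by rewrite -scalemxAl -scalemxAr scalerA.
rewrite /pencil (exprDn_comm _ cc) big1 // => i _.
have [qi|iq] := leqP q i.
  by rewrite -(subnKC qi) (exprD (c.2 *: Y)) (scale _ _ _ Yq) mul0r mulr0 mul0rn.
have pi : (p <= p + q - i)%N by lia.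
by rewrite -(subnKC pi) (exprD (c.1 *: X)) (scale _ _ _ Xp) !mul0r mul0rn.
Qed.

Lemma span2P X Y (Z : 'M[F]_n) :
  Z \in <<[:: X; Y]>>%VS -> exists c, Z = pencil X Y c.
Proof.
rewrite span_cons span_seq1 => /memv_addP[_ /vlineP[a ->] [_ /vlineP[b ->] ->]].
by exists (a, b).
Qed.

(** Only an index s + 1 of Z = aX + bY beyond n/2 + 1 needs an argument. Then
    n < 2s, so s + 1 is also the index of X or of Y and therefore lies in Q;
    the remaining cells of Z are small. *)
Lemma cell_family_nilpotent_family : (0 < n)%N ->
  (forall j : nat, (2 <= j <= n %/ 2 + 1)%N -> Q j) -> nilpotent_family F n M.
Proof.
move=> n0 Qsmall; split.
- by move=> X [].
- by apply: (@nilpotent_with_cells_small _ 1) => [|j]; [rewrite expr1 | lia].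
- move=> g ug; apply/seteqP; split=> [_ [X MX <-]|X MX].
    exact: nilpotent_with_cells_conj.
  exists (invmx g *m X *m g).
    rewrite -{2}(invmxK g); apply: nilpotent_with_cells_conj => //.
    by rewrite unitmx_inv.
  by rewrite !mulmxA mulmxV // mul1mx -mulmxA mulmxV ?mulmx1.
move=> X Y MX MY cXY Z /span2P[c ->].
have nZ := nilpotent_pencil c cXY MX.1 MY.1.
have [s [Z1 Zs]] := nilpotent_mx_index n0 nZ.
have [ns|sn] := ltnP n s.*2; last first.
  by apply: (nilpotent_with_cells_small Z1) => j js; apply: Qsmall; lia.
apply: (nilpotent_with_cells_max Z1 Zs) => [s0|j j2 jn]; last by apply: Qsmall; lia.
by have [[? ?]|[? ?]] := pencil_index cXY MX.1 MY.1 Z1 Zs ns;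
  [apply: (max_cell_allowed MX)|apply: (max_cell_allowed MY)].
Qed.
End CellFamily.

(** * Necessity of the small cells *)

Section SmallCells.
Variable F : fieldType.

Lemma unipotent_unitmx n (X : 'M[F]_n) : nilpotent_mx X -> 1%:M + X \in unitmx.
Proof.
move=> [k Xk]; rewrite -row_free_unit; apply: inj_row_free => w.
rewrite mulmxDr mulmx1 => /eqP; rewrite addr_eq0 => /eqP wX.
have it j : w = (-1) ^+ j *: (w *m X ^+ j).
  elim: j => [|j {1}->]; first by rewrite expr0 scale1r mulmx1.
  by rewrite {1}wX mulNmx exprS mulN1r scaleNr scalerN exprS mulmxA.
by rewrite (it k) Xk mulmx0 scaler0.
Qed.

Lemma jordan_cell_rank_lt p : (\rank (jordan_cell (0 : F) p.+1) <= p)%N.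
Proof.
have [full|] := boolP (row_full (jordan_cell (0 : F) p.+1)); last first.
  by rewrite -ltnS ltn_neqAle rank_leq_row andbT.
have := jordan_cell_exp_eq0 F p.+1 p.+1; rewrite leqnn.
rewrite row_full_unit in full.
have : jordan_cell (0 : F) p.+1 ^+ p.+1 \is a GRing.unit by rewrite unitrX.
by move=> u /eqP e; rewrite e unitr0 in u.
Qed.

Lemma comm_sqr0_exprD (R : pzRingType) (x y : R) k :
  x * y = y * x -> x * x = 0 ->
  (x + y) ^+ k.+1 = y ^+ k.+1 + (x * y ^+ k) *+ k.+1.
Proof.
move=> cxy xx; elim: k => [|k IH]; first by rewrite !expr1 expr0 mulr1 mulr1n addrC.
rewrite exprS IH mulrDl !mulrDr !mulrnAr (mulrA x x) xx mul0r mul0rn addr0.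
by rewrite (mulrA y x) -cxy -(mulrA x y) -!exprS addrCA -mulrS.
Qed.

Section Necessity.
Variables (n : nat) (Q : set nat).
Notation M := (nilpotent_with_cells F n Q).

Lemma nilpotent_family_pencil X Y c : nilpotent_family F n M -> M X -> M Y ->
  X *m Y = Y *m X -> M (pencil X Y c).
Proof.
move=> [_ _ _ h] MX MY cXY; apply: (h X Y) => //.
by rewrite /pencil rpredD // rpredZ // memv_span // !inE eqxx ?orbT.
Qed.

(** Let X consist of one cell of size q >= 3 and cells of size one. Then
    X + X^(q-1) = X (1 + X^(q-2)) has the same index and rank, hence the same
    cell sizes, and commutes with X. The difference X^(q-1) is in the family,
    and it is nonzero of square zero. *)
Lemma two_cell_allowed q :
  nilpotent_family F n M -> Q q -> (2 <= q <= n)%N -> Q 2%N.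
Proof.
move=> fam Qq /andP[q2 qn]; case: q q2 qn Qq => [//|[//|[//|p]]] _ pn Qq.
set d := p.+2.
have [X [X1 Xp rX]] : exists X : 'M[F]_n, [/\ X ^+ d.+1 = 0, X ^+ d != 0 & (\rank X <= d)%N].
  case: n / (subnKC pn) => {fam}; set r := (n - _)%N.
  exists (block_mx (jordan_cell 0 d.+1) 0 0 0); rewrite !block_diag_exp.
  rewrite (eqP (_ : jordan_cell 0 d.+1 ^+ d.+1 == 0)) ?jordan_cell_exp_eq0 //.
  rewrite !expr0n -block_mx0; split=> //.
    apply/eqP => /eq_block_mx[/eqP]; rewrite jordan_cell_exp_eq0; lia.
  by rewrite rank_diag_block_mx mxrank0 addn0 jordan_cell_rank_lt.
have MX : M X by apply: (nilpotent_with_cells_single X1).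
pose N := X ^+ p.+1.
have uN : 1%:M + N \in unitmx.
  by apply: unipotent_unitmx; exists d.+1; rewrite /N -exprM mulnC exprM X1 expr0n.
have cXN : X *m N = N *m X by apply: commrX.
pose Y := X *m (1%:M + N).
have YE : Y = X + X ^+ d by rewrite /Y mulmxDr mulmx1 [X ^+ d]exprS.
have cX1N : GRing.comm X (1%:M + N).
  by rewrite /GRing.comm -[LHS]/(_ *m _) mulmxDr cXN mulmx1 [RHS]mulmxDl mul1mx.
have Yexp k : Y ^+ k = X ^+ k *m (1%:M + N) ^+ k by rewrite (exprMn_comm _ cX1N).
have uNk k : (1%:M + N) ^+ k \in unitmx.
  elim: k => [|k IH]; first by rewrite expr0 unitmx1.
  by rewrite exprS [_ * _]/(_ *m _) unitmx_mul uN.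
have MY : M Y.
  apply: (@nilpotent_with_cells_single _ _ _ _ d) => //.
  - by rewrite Yexp X1 mul0mx.
  - by rewrite Yexp -mxrank_eq0 mxrankMfree ?mxrank_eq0 // row_free_unit.
  - by rewrite /Y mxrankMfree // row_free_unit.
have cXY : X *m Y = Y *m X by rewrite /Y -mulmxA; congr (_ *m _); apply: cX1N.
have := nilpotent_family_pencil (-1, 1) fam MX MY cXY.
rewrite /pencil /= scaleN1r scale1r YE addKr => MXq.
apply: (max_cell_allowed (p := 1) MXq) => //.
rewrite -exprM (_ : d * 2 = d.+1 + p.+1)%N; last by rewrite /d; lia.
by rewrite exprD X1 mul0r.
Qed.

(** In F[x, y]/(x^2, y^j), of dimension 2j, multiplication by x has cells of
    size 2 and by y of size j, while x + y has index j + 1: its power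
    (x+y)^j = j x y^(j-1) does not vanish in characteristic zero. *)
Lemma next_cell_allowed j : nilpotent_family F n M -> [pchar F] =i pred0 ->
  (2 <= j)%N -> (j.*2 <= n)%N -> (forall i, (2 <= i <= j)%N -> Q i) -> Q j.+1.
Proof.
move=> fam char0; case: j => // j j2 jn Qj.
pose J := jordan_cell (0 : F) j.+1.
have [X [Y [cXY XX Y1 XYj]]] : exists X Y : 'M[F]_n,
    [/\ X *m Y = Y *m X, X *m X = 0, Y ^+ j.+1 = 0 & X *m Y ^+ j != 0].
  have n2j : (j.+1 + j.+1 <= n)%N by rewrite addnn.
  case: n / (subnKC n2j) => {fam}; set r := (n - _)%N.
  (* The bases y^i and x y^i, padded with zeros. *)
  exists (block_mx (block_mx 0 1%:M 0 0) 0 0 0), (block_mx (block_mx J 0 0 J) 0 0 0).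
  rewrite !block_diag_exp !mulmx_block !(mulmx0, mul0mx, addr0, add0r, mul1mx, mulmx1).
  rewrite (eqP (_ : J ^+ j.+1 == 0)) ?jordan_cell_exp_eq0 // expr0n -!block_mx0.
  split=> //; apply/eqP => /eq_block_mx[/eq_block_mx[_ /eqP]].
  by rewrite jordan_cell_exp_eq0 ltnn.
have sX : X ^+ 2 = 0 by rewrite expr2.
have MX : M X by apply: (nilpotent_with_cells_small sX) => i ?; apply: Qj; lia.
have MY : M Y by apply: (nilpotent_with_cells_small Y1) => i ?; apply: Qj; lia.
have := nilpotent_family_pencil (1, 1) fam MX MY cXY.
rewrite /pencil /= !scale1r => MXY.
apply: (max_cell_allowed MXY) => //.
  by rewrite comm_sqr0_exprD // [Y ^+ j.+2]exprSr Y1 mul0r add0r mulr0 mul0rn.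
rewrite comm_sqr0_exprD // Y1 add0r -scaler_nat scaler_eq0 ((pcharf0P F).1 char0) //.
Qed.
End Necessity.
End SmallCells.

Theorem theorem1p3 (F : closedFieldType) (n : nat) (n_gt0 : (0 < n)%N)
    (Q : set nat) (subQ : Q `<=` [set j | (2 <= j <= n)%N]) :
  ((forall j : nat, (2 <= j <= n %/ 2 + 1)%N -> Q j) ->
     nilpotent_family F n (nilpotent_with_cells F n Q)) /\
  ([pchar F] =i pred0 -> Q <> set0 ->
     (nilpotent_family F n (nilpotent_with_cells F n Q) <->
      (forall j : nat, (2 <= j <= n %/ 2 + 1)%N -> Q j))).
Proof.
split=> [|char0 Q0]; first exact: cell_family_nilpotent_family.
split=> [fam|]; last exact: cell_family_nilpotent_family.
have [q Qq] : exists q, Q q by apply/set0P/eqP.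
have Q2 := two_cell_allowed fam Qq (subQ q Qq).
suff low j : (j <= n %/ 2 + 1)%N -> forall i, (2 <= i <= j)%N -> Q i.
  by move=> j /andP[j2 jn]; apply: (low j jn); rewrite j2 leqnn.
elim: j => [|j IH] jn i ij; first by lia.
have [e|ne] := eqVneq i j.+1; last by apply: IH; lia.
have [j1|j2] := leqP j 1; first by have -> : i = 2%N by lia.
by rewrite e; apply: (next_cell_allowed fam char0) => //; [lia | apply: IH; lia].
Qed.
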